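(* (Tightening.) Let $\mathbf C$ be a cancellative atomic Markov category with conditionals. Let $f:X\otimes W\to Y\otimes W$, $g:X'\to X$ and $h:Y\to Y'$ be morphisms. If $f$ is traceable, then $(h\otimes\mathrm{id}_W)\circ f\circ(g\otimes\mathrm{id}_W):X'\otimes W\to Y'\otimes W$ is traceable and $$\mathbf{tr}^W\big((h\otimes\mathrm{id}_W)\circ f\circ(g\otimes\mathrm{id}_W)\big)=h\circ\mathbf{tr}^W(f)\circ g.$$
   Context: A Markov category is a symmetric monoidal category $(\mathbf C,\otimes,I)$ in which every object $X$ carries a commutative comonoid $\Delta_X:X\to X\otimes X$, $\mathrm{del}_X:X\to I$, compatible with $\otimes$, and every $f:X\to Y$ satisfies $\mathrm{del}_Y\circ f=\mathrm{del}_X$. Naturality of $\Delta$ is not assumed. Coherence isomorphisms are suppressed. $\mathbf C$ has conditionals if for every $f:A\to X\otimes Y$ there is $f|_X:X\otimes A\to Y$ with $f=(\mathrm{id}_X\otimes f|_X)\circ(\Delta_X\otimes\mathrm{id}_A)\circ\big(((\mathrm{id}_X\otimes\mathrm{del}_Y)\circ f)\otimes\mathrm{id}_A\big)\circ\Delta_A$. For $p:A\to X$ and $f_1,f_2:W\otimes X\to Y$, write $f_1=_pf_2$ if $(f_1\otimes\mathrm{id}_X)\circ(\mathrm{id}_W\otimes(\Delta_X\circ p))=(f_2\otimes\mathrm{id}_X)\circ(\mathrm{id}_W\otimes(\Delta_X\circ p))$. For $p:A\to X$, $q:B\to X$ write $p\ll q$ if for all $W,Y$ and $f_1,f_2:W\otimes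 X\to Y$, $f_1=_qf_2$ implies $f_1=_pf_2$. $p:A\to X$ is atomic if $\Delta_X\circ p\ll p\otimes p$; $\mathbf C$ is atomic if all its morphisms are. An object $W$ is cancellable if $\mathrm{del}_W\otimes f_1=\mathrm{del}_W\otimes f_2$ implies $f_1=f_2$ for all parallel $f_1,f_2$; $\mathbf C$ is cancellative if all objects are cancellable. A morphism $f:X\otimes W'\to Y\otimes W$ is non-signalling (from $W'$ to $W$) if there is $f_s:X\to W$ with $(\mathrm{del}_Y\otimes\mathrm{id}_W)\circ f=f_s\otimes\mathrm{del}_{W'}$. A disintegration of $f$ is a pair $f_s:X\to W$, $f_p:X\otimes W\otimes W'\to Y$ with $f=(f_p\otimes\mathrm{id}_W)\circ(\mathrm{id}_{X\otimes W}\otimes\mathrm{swap}_{W,W'})\circ(s\otimes\mathrm{id}_{W'})$, where $s=(\mathrm{id}_X\otimes(\Delta_W\circ f_s))\circ\Delta_X:X\to X\otimes W\otimes W$. In a Markov category with conditionals, $f$ is non-signalling iff it has a disintegration. $f:X\otimes W\to Y\otimes W$ is called traceable (with respect to $W$) if it is non-signalling from the input $W$ to the output $W$; its causal trace is $\mathbf{tr}^W(f)=f_p\circ s:X\to Y$ for any disintegration (with $W'=W$); under the stated assumptions on $\mathbf C$ this does not depend on the choice of disintegration. *)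

(* Defs.v *)
(* Markov categories over Stdlib; objects form an arbitrary type, equality of
   morphisms is Leibniz equality, and monoidal structures are not assumed
   strict, so the coherence isomorphisms are written out. *)
From Stdlib Require Import ssreflect ClassicalEpsilon.

Set Implicit Arguments.
Unset Strict Implicit.
Unset Printing Implicit Defensive.

Declare Scope mor_scope.
Delimit Scope mor_scope with mor.

Reserved Notation "A ~> B" (at level 90, no associativity).
Reserved Notation "g ∘ f" (at level 40, left associativity).
Reserved Notation "A ⊗ B" (at level 38, left associativity).
Reserved Notation "f ⊠ g" (at level 38, left associativity).

Record category := Category {
  ob :> Type;
  hom : ob -> ob -> Type;
  idm : forall A, hom A A;
  comp : forall A B D, hom B D -> hom A B -> hom A D;
  comp_idl : forall A B (f : hom A B), comp (idm B) f = f;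
  comp_idr : forall A B (f : hom A B), comp f (idm A) = f;
  compA : forall A B D E (h : hom D E) (g : hom B D) (f : hom A B),
    comp h (comp g f) = comp (comp h g) f }.

Arguments hom {c} A B.
Arguments idm {c} A.
Arguments comp {c A B D} g f.

Notation "A ~> B" := (hom A B) : type_scope.
Notation "g ∘ f" := (comp g f) : mor_scope.
Open Scope mor_scope.

Record sym_mon_cat := SymMonCat {
  smc_cat :> category;
  tens : smc_cat -> smc_cat -> smc_cat;
  munit : smc_cat;
  tensm : forall A A' B B' : smc_cat,
    A ~> A' -> B ~> B' -> tens A B ~> tens A' B';
  tensm_id : forall A B, tensm (idm A) (idm B) = idm (tens A B);
  tensm_comp : forall A A' A'' B B' B''
      (f' : A' ~> A'') (f : A ~> A') (g' : B' ~> B'') (g : B ~> B'),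
    tensm (f' ∘ f) (g' ∘ g) = tensm f' g' ∘ tensm f g;
  assoc : forall A B D, tens (tens A B) D ~> tens A (tens B D);
  assoc_inv : forall A B D, tens A (tens B D) ~> tens (tens A B) D;
  lunit : forall A, tens munit A ~> A;
  lunit_inv : forall A, A ~> tens munit A;
  runit : forall A, tens A munit ~> A;
  runit_inv : forall A, A ~> tens A munit;
  swap : forall A B, tens A B ~> tens B A;
  assocK : forall A B D, assoc_inv A B D ∘ assoc A B D = idm _;
  assoc_invK : forall A B D, assoc A B D ∘ assoc_inv A B D = idm _;
  lunitK : forall A, lunit_inv A ∘ lunit A = idm _;
  lunit_invK : forall A, lunit A ∘ lunit_inv A = idm _;
  runitK : forall A, runit_inv A ∘ runit A = idm _;
  runit_invK : forall A, runit A ∘ runit_inv A = idm _;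
  swapK : forall A B, swap B A ∘ swap A B = idm _;
  assoc_nat : forall A A' B B' D D'
      (f : A ~> A') (g : B ~> B') (h : D ~> D'),
    assoc A' B' D' ∘ tensm (tensm f g) h
    = tensm f (tensm g h) ∘ assoc A B D;
  lunit_nat : forall A A' (f : A ~> A'),
    lunit A' ∘ tensm (idm munit) f = f ∘ lunit A;
  runit_nat : forall A A' (f : A ~> A'),
    runit A' ∘ tensm f (idm munit) = f ∘ runit A;
  swap_nat : forall A A' B B' (f : A ~> A') (g : B ~> B'),
    swap A' B' ∘ tensm f g = tensm g f ∘ swap A B;
  pentagon : forall A B D E,
    assoc A B (tens D E) ∘ assoc (tens A B) D E
    = tensm (idm A) (assoc B D E) ∘ assoc A (tens B D) E
        ∘ tensm (assoc A B D) (idm E);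
  triangle : forall A B,
    tensm (idm A) (lunit B) ∘ assoc A munit B = tensm (runit A) (idm B);
  hexagon : forall A B D,
    assoc B D A ∘ swap A (tens B D) ∘ assoc A B D
    = tensm (idm B) (swap A D) ∘ assoc B A D ∘ tensm (swap A B) (idm D) }.

Arguments tens {s} A B.
Arguments munit {s}.
Arguments tensm {s A A' B B'} f g.
Arguments assoc {s} A B D.
Arguments assoc_inv {s} A B D.
Arguments lunit {s} A.
Arguments lunit_inv {s} A.
Arguments runit {s} A.
Arguments runit_inv {s} A.
Arguments swap {s} A B.

Notation "A ⊗ B" := (tens A B) : mor_scope.
Notation "f ⊠ g" := (tensm f g) : mor_scope.

Definition mid_swap (C : sym_mon_cat) (A B D E : C) :
    (A ⊗ B) ⊗ (D ⊗ E) ~> (A ⊗ D) ⊗ (B ⊗ E) :=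
  assoc_inv A D (B ⊗ E)
  ∘ (idm A ⊠ (assoc D B E ∘ (swap B D ⊠ idm E) ∘ assoc_inv B D E))
  ∘ assoc A B (D ⊗ E).

Record markov_cat := MarkovCat {
  mc_smc :> sym_mon_cat;
  copy : forall X : mc_smc, X ~> X ⊗ X;
  del : forall X : mc_smc, X ~> munit;
  copyA : forall X,
    assoc X X X ∘ (copy X ⊠ idm X) ∘ copy X = (idm X ⊠ copy X) ∘ copy X;
  copy_dell : forall X, lunit X ∘ (del X ⊠ idm X) ∘ copy X = idm X;
  copy_delr : forall X, runit X ∘ (idm X ⊠ del X) ∘ copy X = idm X;
  copyC : forall X, swap X X ∘ copy X = copy X;
  copy_tens : forall X Y : mc_smc,
    copy (X ⊗ Y) = mid_swap X X Y Y ∘ (copy X ⊠ copy Y);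
  del_tens : forall X Y : mc_smc,
    del (X ⊗ Y) = lunit munit ∘ (del X ⊠ del Y);
  copy_unit : copy munit = lunit_inv munit;
  del_unit : del munit = idm munit;
  del_nat : forall (X Y : mc_smc) (f : X ~> Y), del Y ∘ f = del X }.

Arguments copy {m} X.
Arguments del {m} X.

Definition is_conditional (C : markov_cat) (A X Y : C)
    (f : A ~> X ⊗ Y) (k : X ⊗ A ~> Y) : Prop :=
  f = (idm X ⊠ k) ∘ assoc X X A ∘ (copy X ⊠ idm A)
        ∘ ((runit X ∘ (idm X ⊠ del Y) ∘ f) ⊠ idm A) ∘ copy A.

Definition has_conditionals (C : markov_cat) : Prop :=
  forall (A X Y : C) (f : A ~> X ⊗ Y), exists k, is_conditional f k.

Definition as_eq (C : markov_cat) (A X W Y : C)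
    (p : A ~> X) (f1 f2 : W ⊗ X ~> Y) : Prop :=
  (f1 ⊠ idm X) ∘ assoc_inv W X X ∘ (idm W ⊠ (copy X ∘ p))
  = (f2 ⊠ idm X) ∘ assoc_inv W X X ∘ (idm W ⊠ (copy X ∘ p)).

Definition abs_cont (C : markov_cat) (A B X : C)
    (p : A ~> X) (q : B ~> X) : Prop :=
  forall (W Y : C) (f1 f2 : W ⊗ X ~> Y), as_eq q f1 f2 -> as_eq p f1 f2.

Definition atomic_mor (C : markov_cat) (A X : C) (p : A ~> X) : Prop :=
  abs_cont (copy X ∘ p) (p ⊠ p).

Definition atomic (C : markov_cat) : Prop :=
  forall (A X : C) (p : A ~> X), atomic_mor p.

Definition cancellable (C : markov_cat) (W : C) : Prop :=
  forall (A B : C) (f1 f2 : A ~> B), del W ⊠ f1 = del W ⊠ f2 -> f1 = f2.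

Definition cancellative (C : markov_cat) : Prop :=
  forall W : C, cancellable W.

(* Non-signalling from W' to W; the unitors identify both sides as morphisms
   X ⊗ W' ~> W. *)
Definition nonsignalling (C : markov_cat) (X W' Y W : C)
    (f : X ⊗ W' ~> Y ⊗ W) : Prop :=
  exists fs : X ~> W,
    lunit W ∘ (del Y ⊠ idm W) ∘ f = runit W ∘ (fs ⊠ del W').

Definition disint_state (C : markov_cat) (X W : C) (fs : X ~> W) :
    X ~> (X ⊗ W) ⊗ W :=
  assoc_inv X W W ∘ (idm X ⊠ (copy W ∘ fs)) ∘ copy X.

Definition is_disintegration (C : markov_cat) (X W' Y W : C)
    (f : X ⊗ W' ~> Y ⊗ W) (fs : X ~> W) (fp : (X ⊗ W) ⊗ W' ~> Y) : Prop :=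
  f = (fp ⊠ idm W) ∘ assoc_inv (X ⊗ W) W' W ∘ (idm (X ⊗ W) ⊠ swap W W')
        ∘ assoc (X ⊗ W) W W' ∘ (disint_state fs ⊠ idm W').

Definition traceable (C : markov_cat) (X Y W : C)
    (f : X ⊗ W ~> Y ⊗ W) : Prop :=
  nonsignalling f.

(* Existence of disintegrations, needed to define the causal trace. *)

Section Coherence.
Variable C : sym_mon_cat.
Implicit Types A B D E X Y W : C.

Lemma pre_comp A B D E (a : D ~> E) (b : B ~> D) (c : B ~> E) :
  a ∘ b = c -> forall x : A ~> B, a ∘ (b ∘ x) = c ∘ x.
Proof. by move=> <- x; rewrite compA. Qed.

Lemma tensm_split A A' B B' (f : A ~> A') (g : B ~> B') :
  f ⊠ g = (f ⊠ idm B') ∘ (idm A ⊠ g).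
Proof. by rewrite -tensm_comp comp_idr comp_idl. Qed.

Lemma tensm_exch A A' B B' (f : A ~> A') (g : B ~> B') :
  (idm A' ⊠ g) ∘ (f ⊠ idm B) = (f ⊠ idm B') ∘ (idm A ⊠ g).
Proof. by rewrite -!tensm_comp !comp_idl !comp_idr. Qed.

Lemma tensm_compr A B B' B'' (g' : B' ~> B'') (g : B ~> B') :
  (idm A ⊠ g') ∘ (idm A ⊠ g) = idm A ⊠ (g' ∘ g).
Proof. by rewrite -tensm_comp comp_idl. Qed.

Lemma tensm_compl A B B' B'' (g' : B' ~> B'') (g : B ~> B') :
  (g' ⊠ idm A) ∘ (g ⊠ idm A) = (g' ∘ g) ⊠ idm A.
Proof. by rewrite -tensm_comp comp_idl. Qed.

Lemma assoc_epi A B D E (a b : A ⊗ (B ⊗ D) ~> E) :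
  a ∘ assoc A B D = b ∘ assoc A B D -> a = b.
Proof.
move=> H; rewrite -(comp_idr a) -(comp_idr b) -assoc_invK.
by rewrite !compA H.
Qed.

Lemma assoc_mono A B D E (a b : E ~> (A ⊗ B) ⊗ D) :
  assoc A B D ∘ a = assoc A B D ∘ b -> a = b.
Proof.
by move=> H; rewrite -(comp_idl a) -(comp_idl b) -assocK -!compA H.
Qed.

Lemma assoc_inv_nat A A' B B' D D'
    (f : A ~> A') (g : B ~> B') (h : D ~> D') :
  assoc_inv A' B' D' ∘ (f ⊠ (g ⊠ h)) = ((f ⊠ g) ⊠ h) ∘ assoc_inv A B D.
Proof.
apply: assoc_epi; rewrite -!compA assocK comp_idr.
by rewrite -assoc_nat compA assocK comp_idl.
Qed.

Lemma tens_unit_inj A B (f g : A ~> B) :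
  idm munit ⊠ f = idm munit ⊠ g -> f = g.
Proof.
move=> H; rewrite -(comp_idr f) -(comp_idr g) -lunit_invK.
by rewrite !compA -!lunit_nat H.
Qed.

Lemma lunit_tens A B : lunit (A ⊗ B) ∘ assoc munit A B = lunit A ⊠ idm B.
Proof.
apply: tens_unit_inj.
have epi : forall Z (u v : munit ⊗ ((munit ⊗ A) ⊗ B) ~> Z),
    u ∘ (assoc munit (munit ⊗ A) B ∘ (assoc munit munit A ⊠ idm B))
    = v ∘ (assoc munit (munit ⊗ A) B ∘ (assoc munit munit A ⊠ idm B)) -> u = v.
  move=> Z u v H; apply: assoc_epi.
  rewrite -(comp_idr (u ∘ _)) -(comp_idr (v ∘ _)) -tensm_id.
  by rewrite -(assoc_invK munit munit A) -tensm_compl !compA -2!compA !compA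
     -(compA u) H -!compA.
apply: epi.
rewrite -tensm_compr -compA (compA (idm _ ⊠ assoc _ _ _)) -pentagon.
rewrite compA triangle -[in LHS]tensm_id -assoc_nat.
rewrite compA -assoc_nat -compA tensm_compl triangle.
by [].
Qed.

Lemma hexagon_inv A B D :
  assoc_inv D A B ∘ swap (A ⊗ B) D
  = (swap A D ⊠ idm B) ∘ assoc_inv A D B ∘ (idm A ⊠ swap B D) ∘ assoc A B D.
Proof.
have H := hexagon D A B.
have iso (a a' : (A ⊗ B) ⊗ D ~> (D ⊗ A) ⊗ B) :
  (assoc A B D ∘ swap D (A ⊗ B) ∘ assoc D A B) ∘ a
  = (assoc A B D ∘ swap D (A ⊗ B) ∘ assoc D A B) ∘ a' -> a = a'.
  rewrite -!compA => /(f_equal (comp (assoc_inv _ _ _))).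
  rewrite !(pre_comp (assocK _ _ _)) !comp_idl.
  move=> /(f_equal (comp (swap _ _))).
  rewrite !(pre_comp (swapK _ _)) !comp_idl.
  exact: assoc_mono.
apply: iso; rewrite {2}H -!compA (pre_comp (assoc_invK _ _ _)) comp_idl.
rewrite swapK comp_idr (compA (swap D A ⊠ _)) tensm_compl swapK tensm_id comp_idl.
rewrite (pre_comp (assoc_invK _ _ _)) comp_idl.
by rewrite compA tensm_compr swapK tensm_id comp_idl.
Qed.

Lemma runit_swap A : lunit A ∘ swap A munit = runit A.
Proof.
have inj : forall B (f g : A ⊗ munit ~> B),
    f ⊠ idm munit = g ⊠ idm munit -> f = g.
  move=> B f g H; rewrite -(comp_idr f) -(comp_idr g) -runit_invK.
  by rewrite !compA -!runit_nat H.
apply: inj; rewrite -tensm_compl -lunit_tens.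
rewrite -[LHS]comp_idl -[RHS]comp_idl -(swapK A munit) -!compA; congr (_ ∘ _).
rewrite (pre_comp (eq_sym (lunit_nat _))) -!compA.
have H := hexagon A munit munit; rewrite -!compA in H; rewrite -H.
rewrite (pre_comp (lunit_tens _ _)) (pre_comp (eq_sym (swap_nat _ _))) -compA.
by rewrite triangle.
Qed.

Lemma mid_swap_nat A A' B B' D D' E E' (a : A ~> A') (b : B ~> B')
    (d : D ~> D') (e : E ~> E') :
  mid_swap A' B' D' E' ∘ ((a ⊠ b) ⊠ (d ⊠ e))
  = ((a ⊠ d) ⊠ (b ⊠ e)) ∘ mid_swap A B D E.
Proof.
have brk : assoc D' B' E' ∘ (swap B' D' ⊠ idm E') ∘ assoc_inv B' D' E'
      ∘ (b ⊠ (d ⊠ e))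
    = (d ⊠ (b ⊠ e))
      ∘ (assoc D B E ∘ (swap B D ⊠ idm E) ∘ assoc_inv B D E).
  rewrite -!compA assoc_inv_nat (compA (_ ⊠ _) (_ ⊠ _)) -tensm_comp.
  rewrite swap_nat comp_idl !compA -assoc_nat -2![in RHS]compA.
  by rewrite (compA (_ ⊠ _) (_ ⊠ _)) -tensm_comp comp_idr !compA.
rewrite /mid_swap -2!compA assoc_nat (compA (_ ⊠ _) (_ ⊠ _)) -tensm_comp.
by rewrite brk comp_idl -[a in LHS]comp_idr tensm_comp !compA assoc_inv_nat.
Qed.

Lemma tens_copy_unit A B D :
  (runit A ⊠ idm (B ⊗ D)) ∘ mid_swap A B munit D
    ∘ (idm (A ⊗ B) ⊠ lunit_inv D) = assoc A B D.
Proof.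
rewrite /mid_swap -triangle -!compA.
rewrite (pre_comp (assoc_invK _ _ _)) comp_idl.
rewrite -[in X in X ⊠ lunit_inv D]tensm_id assoc_nat !compA !tensm_compr.
rewrite -[RHS]comp_idl; congr (_ ∘ _); rewrite -tensm_id; congr (_ ⊠ _).
rewrite !compA lunit_tens tensm_compl runit_swap -triangle -compA.
rewrite -!compA (pre_comp (assoc_invK _ _ _)) comp_idl tensm_compr lunit_invK.
exact: tensm_id.
Qed.

Lemma tens_copy_unit_pre A B D E (u : E ~> A ⊗ B) :
  (runit A ⊠ idm (B ⊗ D)) ∘ (mid_swap A B munit D ∘ (u ⊠ lunit_inv D))
  = assoc A B D ∘ (u ⊠ idm D).
Proof.
rewrite -tens_copy_unit -[RHS]compA tensm_exch -tensm_split.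
by rewrite [LHS]compA.
Qed.

(* Both sides send (w1, w2, x, w') to ((w1, (x, w')), w2). *)
Lemma disint_coherence W X V :
  swap W (W ⊗ (X ⊗ V)) ∘ assoc W W (X ⊗ V) ∘ assoc (W ⊗ W) X V
    ∘ ((swap W W ⊠ idm X) ⊠ idm V)
  = ((assoc W X V ∘ (swap X W ⊠ idm V)) ⊠ idm W)
    ∘ assoc_inv (X ⊗ W) V W ∘ (idm (X ⊗ W) ⊠ swap W V)
    ∘ assoc (X ⊗ W) W V ∘ (assoc_inv X W W ⊠ idm V)
    ∘ (swap (W ⊗ W) X ⊠ idm V).
Proof.
have pent A B D E : assoc_inv A (B ⊗ D) E ∘ (idm A ⊠ assoc_inv B D E)
    ∘ assoc A B (D ⊗ E) = (assoc A B D ⊠ idm E) ∘ assoc_inv (A ⊗ B) D E.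
  apply: assoc_epi; rewrite -!compA pentagon assocK comp_idr -!compA.
  rewrite (compA (idm _ ⊠ _)) tensm_compr assocK tensm_id comp_idl.
  by rewrite compA assocK comp_idl.
have hex A B D : swap A (B ⊗ D) ∘ assoc A B D
    = assoc_inv B D A ∘ (idm B ⊠ swap A D) ∘ assoc B A D
        ∘ (swap A B ⊠ idm D).
  by rewrite -2!compA (compA (idm _ ⊠ _)) -hexagon -!compA
     (pre_comp (assocK _ _ _)) comp_idl.
rewrite -[RHS]compA tensm_compl hexagon_inv.
have nat1 A A' B D (f : A ~> A') :
    assoc A' B D ∘ ((f ⊠ idm B) ⊠ idm D) = (f ⊠ idm (B ⊗ D)) ∘ assoc A B D.
  by rewrite assoc_nat tensm_id.
rewrite hex -!compA nat1.
rewrite (compA (_ ⊠ _) (_ ⊠ _) (assoc _ _ _)) tensm_compl swapK tensm_id comp_idl.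
rewrite pentagon -!compA (compA (idm W ⊠ swap W (X ⊗ V))) tensm_compr hex.
rewrite -!tensm_compl -!tensm_compr -!compA.
have pent2 A B D E : (idm A ⊠ assoc B D E) ∘ assoc A (B ⊗ D) E
    = assoc A B (D ⊗ E) ∘ assoc (A ⊗ B) D E ∘ (assoc_inv A B D ⊠ idm E).
  rewrite pentagon -!compA tensm_compl assoc_invK tensm_id.
  by rewrite comp_idr.
rewrite (pre_comp (nat1 _ _ _ _ _)) -compA (pre_comp (tensm_exch _ _)) -compA.
rewrite -[idm (V ⊗ W)]tensm_id (pre_comp (assoc_inv_nat _ _ _)) -compA.
rewrite (compA (swap X W ⊠ _ ⊠ _)) 2!tensm_compl swapK !tensm_id comp_idl.
rewrite (pre_comp (eq_sym (assoc_nat _ _ _))) -!compA.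
rewrite (pre_comp (pent2 _ _ _ _)) -!compA.
rewrite (pre_comp (eq_sym (assoc_nat _ _ _))) tensm_id -!compA.
by rewrite (compA (assoc_inv _ _ _)) (compA (_ ∘ _)) pent -!compA.
Qed.

End Coherence.

Lemma nonsignalling_disintegration (C : markov_cat)
    (hC : has_conditionals C) (X W' Y W : C) (f : X ⊗ W' ~> Y ⊗ W) :
  nonsignalling f -> exists fs fp, is_disintegration f fs fp.
Proof.
case=> fs ns; have [k hk] := hC _ _ _ (swap Y W ∘ f).
exists fs, (k ∘ (assoc W X W' ∘ (swap X W ⊠ idm W'))).
pose u := (fs ⊠ idm X) ∘ copy X.
have marg : runit W ∘ (idm W ⊠ del Y) ∘ (swap Y W ∘ f)
    = runit W ∘ (fs ⊠ del W').
  rewrite -ns -(runit_swap W) -!compA.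
  rewrite (pre_comp (swap_nat _ _)) -!compA.
  by rewrite (pre_comp (swapK _ _)) comp_idl.
have del_lunit : (del W' ⊠ idm W') ∘ copy W' = lunit_inv W'.
  rewrite -[LHS]comp_idl -lunitK -!compA [X in _ ∘ X = _]compA copy_dell.
  by rewrite comp_idr.
have state : ((runit W ∘ (fs ⊠ del W')) ⊠ idm (X ⊗ W')) ∘ copy (X ⊗ W')
    = assoc W X W' ∘ (u ⊠ idm W').
  rewrite copy_tens -tensm_compl -[idm (X ⊗ W') in X in _ ∘ X ∘ _]tensm_id.
  rewrite -compA (pre_comp (eq_sym (mid_swap_nat _ _ _ _))).
  rewrite -[X in _ ∘ X = _]compA -tensm_comp del_lunit.
  exact: tens_copy_unit_pre.
have cstate : disint_state fs
    = assoc_inv X W W ∘ swap (W ⊗ W) X ∘ ((copy W ⊠ idm X) ∘ u).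
  rewrite /disint_state -!compA; congr (_ ∘ _).
  rewrite /u (pre_comp (swap_nat _ _)) -compA.
  rewrite (pre_comp (swap_nat _ _)) -compA copyC.
  by rewrite compA tensm_compr.
rewrite /is_conditional marg in hk.
rewrite /is_disintegration -[LHS]comp_idl -(swapK Y W) -[LHS]compA hk.
rewrite -!compA state (pre_comp (swap_nat _ _)) -[LHS]compA.
rewrite -tensm_compl -[RHS]compA; congr (_ ∘ _).
rewrite cstate -[copy W in LHS]copyC.
have -> : (swap W W ∘ copy W) ⊠ idm (X ⊗ W') ∘ (assoc W X W' ∘ (u ⊠ idm W'))
    = assoc (W ⊗ W) X W' ∘ (((swap W W ⊠ idm X) ⊠ idm W')
        ∘ (((copy W ⊠ idm X) ∘ u) ⊠ idm W')).
  rewrite -(tensm_id X W') (pre_comp (eq_sym (assoc_nat _ _ _))) -[LHS]compA.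
  by congr (_ ∘ _); rewrite !tensm_compl [in RHS]compA tensm_compl.
by rewrite 3![LHS]compA disint_coherence -!tensm_compl -!compA.
Qed.

Definition is_causal_trace (C : markov_cat) (X Y W : C)
    (f : X ⊗ W ~> Y ⊗ W) (t : X ~> Y) : Prop :=
  exists (fs : X ~> W) (fp : (X ⊗ W) ⊗ W ~> Y),
    is_disintegration f fs fp /\ t = fp ∘ disint_state fs.

Lemma causal_trace_exists (C : markov_cat) (hC : has_conditionals C)
    (X Y W : C) (f : X ⊗ W ~> Y ⊗ W) :
  traceable f -> exists t, is_causal_trace f t.
Proof.
move=> /(nonsignalling_disintegration hC) [fs [fp fE]].
by exists (fp ∘ disint_state fs), fs, fp.
Qed.

(* Defined from an arbitrarily chosen disintegration; that the result does not
   depend on the choice holds in cancellative atomic Markov categories with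
   conditionals, and is not built into the definition. *)
Definition causal_trace (C : markov_cat) (hC : has_conditionals C)
    (X Y W : C) (f : X ⊗ W ~> Y ⊗ W) (hf : traceable f) : X ~> Y :=
  proj1_sig (constructive_indefinite_description _ (causal_trace_exists hC hf)).

(* Main.v *)
(* Write q = <id, f_s> : X -> X ⊗ W, so that a disintegration says
   f(x, w') = (f_p(q(x), w'), w) with w the second component of q(x), and the
   causal trace feeds this w back into w'.

   The trace does not depend on the disintegration: f_s is determined by f
   because W is cancellable; two choices of f_p agree q-almost surely, so
   f_p((x1, w1), w2) as a function of (x1, w1, x2, w2) is determined almost
   surely for q ⊗ q, and hence, q being atomic, almost surely for copy ∘ q,
   which is where w1 and w2 coincide.

   For tightening, the conditional of <f_s, id> ∘ g given its W-component is a
   map κ over W with q ∘ g = κ ∘ <id, f_s ∘ g>. Therefore f_s ∘ g and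
   h ∘ f_p ∘ (κ ⊗ id) disintegrate (h ⊗ id) ∘ f ∘ (g ⊗ id), and the trace
   computed from them is h ∘ tr(f) ∘ g. *)
From Stdlib Require Import ssreflect ClassicalEpsilon.
Require Import Defs.

Set Implicit Arguments.
Unset Strict Implicit.
Unset Printing Implicit Defensive.

(** * Projections and pairings in a Markov category *)

Section Calculus.
Variable C : markov_cat.
Implicit Types A B D E X Y Z W : C.

Definition pr1 {A B} : A ⊗ B ~> A := runit A ∘ (idm A ⊠ del B).
Definition pr2 {A B} : A ⊗ B ~> B := lunit B ∘ (del A ⊠ idm B).
Definition pair {Z A B} (f : Z ~> A) (g : Z ~> B) : Z ~> A ⊗ B :=
  (f ⊠ g) ∘ copy Z.
Definition deterministic {A B} (f : A ~> B) : Prop :=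
  copy B ∘ f = pair f f.

Notation "⟨ f , g ⟩" := (pair f g) (at level 0, format "⟨ f ,  g ⟩").

Lemma tensm_pair Z A A' B B' (a : A ~> A') (b : B ~> B')
    (f : Z ~> A) (g : Z ~> B) : (a ⊠ b) ∘ ⟨f, g⟩ = ⟨a ∘ f, b ∘ g⟩.
Proof. by rewrite /pair compA -tensm_comp. Qed.

(** Copying is not natural, so [d] is required to commute with it. For a random morphism,
    [pair_tensm_exch] serves as a partial substitute. *)
Lemma pair_deterministic Z Z' A B (f : Z ~> A) (g : Z ~> B) (d : Z' ~> Z) :
  deterministic d -> ⟨f, g⟩ ∘ d = ⟨f ∘ d, g ∘ d⟩.
Proof. by move=> dd; rewrite {1}/pair -compA dd tensm_pair. Qed.

Lemma pr1_tensm A A' B B' (a : A ~> A') (b : B ~> B') :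
  pr1 ∘ (a ⊠ b) = a ∘ pr1.
Proof.
by rewrite /pr1 -compA -tensm_comp del_nat comp_idl compA -runit_nat -compA
   -tensm_comp comp_idl comp_idr.
Qed.

Lemma pr2_tensm A A' B B' (a : A ~> A') (b : B ~> B') :
  pr2 ∘ (a ⊠ b) = b ∘ pr2.
Proof.
by rewrite /pr2 -compA -tensm_comp del_nat comp_idl compA -lunit_nat -compA
   -tensm_comp comp_idl comp_idr.
Qed.

Lemma pr1_pair Z A B (f : Z ~> A) (g : Z ~> B) : pr1 ∘ ⟨f, g⟩ = f.
Proof. by rewrite /pair compA pr1_tensm -compA /pr1 copy_delr comp_idr. Qed.

Lemma pr2_pair Z A B (f : Z ~> A) (g : Z ~> B) : pr2 ∘ ⟨f, g⟩ = g.
Proof. by rewrite /pair compA pr2_tensm -compA /pr2 copy_dell comp_idr. Qed.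

Lemma swap_pair Z A B (f : Z ~> A) (g : Z ~> B) : swap A B ∘ ⟨f, g⟩ = ⟨g, f⟩.
Proof. by rewrite /pair compA swap_nat -compA copyC. Qed.

Lemma assoc_pair Z A B D (f : Z ~> A) (g : Z ~> B) (h : Z ~> D) :
  assoc A B D ∘ ⟨⟨f, g⟩, h⟩ = ⟨f, ⟨g, h⟩⟩.
Proof.
rewrite /pair -[h in LHS]comp_idr tensm_comp 2!compA assoc_nat -2!compA.
by rewrite (compA (assoc _ _ _)) copyA compA -tensm_comp comp_idr.
Qed.

Lemma assoc_inv_pair Z A B D (f : Z ~> A) (g : Z ~> B) (h : Z ~> D) :
  assoc_inv A B D ∘ ⟨f, ⟨g, h⟩⟩ = ⟨⟨f, g⟩, h⟩.
Proof. by rewrite -assoc_pair compA assocK comp_idl. Qed.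

Lemma copy_pair A : copy A = ⟨idm A, idm A⟩.
Proof. by rewrite /pair tensm_id comp_idl. Qed.

Lemma copy_del_l A : (del A ⊠ idm A) ∘ copy A = lunit_inv A.
Proof.
rewrite -[LHS]comp_idl -lunitK -!compA [X in _ ∘ X]compA.
by rewrite copy_dell comp_idr.
Qed.

Lemma copy_del_r A : (idm A ⊠ del A) ∘ copy A = runit_inv A.
Proof.
rewrite -[LHS]comp_idl -runitK -!compA [X in _ ∘ X]compA.
by rewrite copy_delr comp_idr.
Qed.

Lemma tens_unit_inj_r A B (f g : A ~> B) :
  f ⊠ idm munit = g ⊠ idm munit -> f = g.
Proof.
move=> H; rewrite -(comp_idr f) -(comp_idr g) -runit_invK.
by rewrite !compA -!runit_nat H.
Qed.

(** By [copy_tens], both factors are copied and interchanged; deleting one copy of each leaves only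
    unitors, which cancel by coherence. *)
Lemma pair_pr A B : ⟨pr1, pr2⟩ = idm (A ⊗ B).
Proof.
rewrite /pair copy_tens compA /pr1 /pr2 tensm_comp.
rewrite -(compA _ _ (mid_swap _ _ _ _)) -mid_swap_nat.
rewrite -2!compA -tensm_comp copy_del_l copy_del_r.
rewrite -[runit A in LHS]comp_idl -[lunit B in LHS]comp_idr tensm_comp -compA.
by rewrite tens_copy_unit_pre compA triangle tensm_compl runit_invK tensm_id.
Qed.

Lemma runit_tens A B : (idm A ⊠ runit B) ∘ assoc A B munit = runit (A ⊗ B).
Proof.
apply: tens_unit_inj_r; apply: assoc_mono.
rewrite -tensm_compl compA assoc_nat -triangle.
rewrite -tensm_compr -!compA (compA (idm A ⊠ assoc _ _ _)) -pentagon.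
by rewrite compA -assoc_nat tensm_id -!compA -triangle.
Qed.

(** * Deterministic morphisms *)

Lemma del_copy A : (del A ⊠ del A) ∘ copy A = lunit_inv munit ∘ del A.
Proof.
rewrite -[LHS]comp_idl -lunitK -!compA (compA (lunit _)).
by rewrite -del_tens del_nat.
Qed.

(** Copying a pair and deleting both copies of [B] is the same as deleting [B] at once, so only the
    copy of [A] survives. *)
Lemma pr1_deterministic A B : deterministic (@pr1 A B).
Proof.
rewrite /deterministic /pair copy_tens {2 3}/pr1 tensm_comp -[RHS]compA.
rewrite (compA _ (mid_swap _ _ _ _)) -mid_swap_nat -compA -tensm_comp del_copy.
rewrite tensm_id comp_idl -[copy A in X in _ = X]comp_idr tensm_comp.
rewrite (tensm_split (runit A)) -(tensm_exch (runit A) (runit A)).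
rewrite (compA (mid_swap _ _ _ _)) -[RHS]compA (compA (runit A ⊠ _)).
rewrite tens_copy_unit_pre.
by rewrite 2!compA runit_tens runit_nat -compA.
Qed.

Lemma lunit_swap A : runit A ∘ swap munit A = lunit A.
Proof. by rewrite -runit_swap -compA swapK comp_idr. Qed.

Lemma pr2_deterministic A B : deterministic (@pr2 A B).
Proof.
rewrite /deterministic /pair copy_tens {2 3}/pr2 tensm_comp -[RHS]compA.
rewrite (compA _ (mid_swap _ _ _ _)) -mid_swap_nat -compA -tensm_comp del_copy.
rewrite tensm_id comp_idl -[copy B in RHS]comp_idl tensm_comp.
rewrite (tensm_split (lunit B)) -(tensm_exch (lunit B) (lunit B)).
rewrite -lunit_tens /mid_swap -!compA (compA (assoc _ _ _) (assoc_inv _ _ _)).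
rewrite assoc_invK comp_idl (compA (lunit (B ⊗ _)) (idm _ ⊠ _)) lunit_nat -compA.
rewrite (compA (lunit _) (assoc _ _ _)) lunit_tens.
rewrite (compA (lunit munit ⊠ _)) tensm_compl lunit_invK tensm_id comp_idl.
rewrite !compA triangle tensm_compl lunit_swap -lunit_tens.
rewrite -(compA _ (assoc _ _ _)) assoc_invK comp_idr.
rewrite (tensm_split (del A) (copy B)) -(tensm_exch (del A)).
by rewrite /pr2 !compA lunit_nat.
Qed.

Lemma mid_swap_pair Z A B D E (a : Z ~> A) (b : Z ~> B) (d : Z ~> D)
    (e : Z ~> E) :
  mid_swap A B D E ∘ ⟨⟨a, b⟩, ⟨d, e⟩⟩ = ⟨⟨a, d⟩, ⟨b, e⟩⟩.
Proof.
rewrite /mid_swap -!compA assoc_pair tensm_pair comp_idl -!compA.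
rewrite assoc_inv_pair tensm_pair comp_idl swap_pair assoc_pair.
exact: assoc_inv_pair.
Qed.

Lemma deterministic_pair Z A B (f : Z ~> A) (g : Z ~> B) :
  deterministic f -> deterministic g -> deterministic ⟨f, g⟩.
Proof.
rewrite /deterministic => df dg.
by rewrite copy_tens -compA tensm_pair df dg mid_swap_pair.
Qed.

Lemma deterministic_id A : deterministic (idm A).
Proof. by rewrite /deterministic comp_idr copy_pair. Qed.

Lemma deterministic_comp A B D (g : B ~> D) (f : A ~> B) :
  deterministic g -> deterministic f -> deterministic (g ∘ f).
Proof.
move=> dg df; rewrite /deterministic compA dg.
exact: pair_deterministic.
Qed.

(** * Tensor products and wirings expressed by pairings *)

Lemma tensmE A A' B B' (f : A ~> A') (g : B ~> B') :
  f ⊠ g = ⟨f ∘ pr1, g ∘ pr2⟩.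
Proof. by rewrite -[LHS]comp_idr -pair_pr tensm_pair. Qed.

Lemma pr_pair A B Z (d : Z ~> A ⊗ B) :
  deterministic d -> ⟨pr1 ∘ d, pr2 ∘ d⟩ = d.
Proof. by move=> dd; rewrite -pair_deterministic // pair_pr comp_idl. Qed.

Lemma assoc_inv_copy A B : assoc_inv A B B ∘ (idm A ⊠ copy B) = ⟨idm _, pr2⟩.
Proof.
rewrite tensmE comp_idl pr2_deterministic assoc_inv_pair.
by rewrite pair_pr.
Qed.

Lemma assoc_copy A B : assoc A A B ∘ (copy A ⊠ idm B) = ⟨pr1, idm _⟩.
Proof.
rewrite tensmE comp_idl pr1_deterministic assoc_pair.
by rewrite pair_pr.
Qed.

(** This is the wiring inside [is_disintegration]: the late input moves past the retained output. *)
Definition swap_last A B D : (A ⊗ B) ⊗ D ~> (A ⊗ D) ⊗ B :=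
  assoc_inv A D B ∘ (idm A ⊠ swap B D) ∘ assoc A B D.

Lemma swap_last_pair Z A B D (a : Z ~> A) (b : Z ~> B) (d : Z ~> D) :
  swap_last A B D ∘ ⟨⟨a, b⟩, d⟩ = ⟨⟨a, d⟩, b⟩.
Proof.
by rewrite /swap_last -!compA assoc_pair tensm_pair swap_pair comp_idl
   assoc_inv_pair.
Qed.

Lemma swap_last_nat A A' B B' D D' (a : A ~> A') (b : B ~> B') (d : D ~> D') :
  swap_last A' B' D' ∘ ((a ⊠ b) ⊠ d) = ((a ⊠ d) ⊠ b) ∘ swap_last A B D.
Proof.
rewrite /swap_last -!compA assoc_nat (compA (idm _ ⊠ _)) -tensm_comp.
rewrite swap_nat comp_idl -[a in LHS]comp_idr tensm_comp -compA.
by rewrite compA assoc_inv_nat -compA.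
Qed.

Lemma swap_last_pair_tensm Z A B D (k : Z ~> A) (v : Z ~> B) :
  swap_last A B D ∘ (⟨k, v⟩ ⊠ idm D) = ⟨k ⊠ idm D, v ∘ pr1⟩.
Proof.
rewrite {1}/pair -tensm_compl compA swap_last_nat -compA.
rewrite (tensmE (copy Z)) pr1_deterministic swap_last_pair comp_idl pair_pr.
by rewrite tensm_pair comp_idr.
Qed.

(** Here [κ] may be random. The hypothesis lets [u], read jointly with the output of [κ], be
    replaced by [v] on its input; [swap_last] carries the spectator [E] around this exchange. *)
Lemma pair_tensm_exch A B D E (κ : A ~> B) (u : B ~> D) (v : A ~> D) :
  ⟨idm B, u⟩ ∘ κ = ⟨κ, v⟩ ->
  ⟨idm _, u ∘ pr1⟩ ∘ (κ ⊠ idm E) = ⟨κ ⊠ idm E, v ∘ pr1⟩.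
Proof.
move=> H; rewrite -[in LHS]tensm_id -swap_last_pair_tensm.
by rewrite -compA tensm_compl H swap_last_pair_tensm.
Qed.

(** * Graphs and disintegrations *)

Definition graph A B (f : A ~> B) : A ~> A ⊗ B := ⟨idm A, f⟩.

(** The output of a graph still contains its input, even for random [f]; this is the hypothesis of
    [pair_tensm_exch] for [graph f]. *)
Lemma graph_copy A B (f : A ~> B) :
  ⟨idm _, pr1⟩ ∘ graph f = ⟨graph f, idm A⟩.
Proof.
rewrite /graph.
have := swap_last_pair_tensm B (idm A) (idm A).
rewrite tensm_id comp_idl => <-.
by rewrite -compA tensm_pair -copy_pair !comp_idl !comp_idr copy_pair
  swap_last_pair.
Qed.

Lemma pair_pr2_copy Z A B (f : Z ~> A) (g : Z ~> B) : deterministic g ->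
  ⟨idm _, pr2⟩ ∘ ⟨f, g⟩ = ⟨⟨f, g⟩, g⟩.
Proof.
move=> dg; rewrite -assoc_inv_copy -compA tensm_pair comp_idl dg.
exact: assoc_inv_pair.
Qed.

Lemma disint_stateE X W (fs : X ~> W) :
  disint_state fs = ⟨idm _, pr2⟩ ∘ graph fs.
Proof.
rewrite /disint_state -tensm_compr compA assoc_inv_copy -compA.
by rewrite -/(pair _ _).
Qed.

Lemma disintegrationE X W' Y W (f : X ⊗ W' ~> Y ⊗ W) (fs : X ~> W)
    (fp : (X ⊗ W) ⊗ W' ~> Y) :
  is_disintegration f fs fp <->
  f = ⟨fp, pr2 ∘ pr1⟩ ∘ (graph fs ⊠ idm W').
Proof.
rewrite /is_disintegration disint_stateE.
have -> : (fp ⊠ idm W) ∘ assoc_inv (X ⊗ W) W' W ∘ (idm (X ⊗ W) ⊠ swap W W')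
    ∘ assoc (X ⊗ W) W W' ∘ ((⟨idm _, pr2⟩ ∘ graph fs) ⊠ idm W')
  = (fp ⊠ idm W) ∘ (swap_last (X ⊗ W) W W' ∘ (⟨idm _, pr2⟩ ⊠ idm W'))
    ∘ (graph fs ⊠ idm W').
  by rewrite /swap_last -tensm_compl -!compA.
by rewrite swap_last_pair_tensm tensm_pair tensm_id comp_idl comp_idr.
Qed.

Lemma disintegration_state X W' Y W (f : X ⊗ W' ~> Y ⊗ W) (fs : X ~> W)
    (fp : (X ⊗ W) ⊗ W' ~> Y) :
  is_disintegration f fs fp -> pr2 ∘ f = fs ∘ pr1.
Proof.
move=> /disintegrationE ->.
by rewrite compA pr2_pair -compA pr1_tensm compA pr2_pair.
Qed.

Lemma disintegration_nonsignalling X W' Y W (f : X ⊗ W' ~> Y ⊗ W)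
    (fs : X ~> W) (fp : (X ⊗ W) ⊗ W' ~> Y) :
  is_disintegration f fs fp -> nonsignalling f.
Proof.
move=> /disintegration_state H; exists fs; rewrite -/pr2 H /pr1 compA.
by rewrite -runit_nat -compA -tensm_comp comp_idr comp_idl.
Qed.

(** * Uniqueness of the causal trace *)

Lemma cancel_pr1 W A B (f1 f2 : A ~> B) : cancellable W ->
  f1 ∘ @pr1 A W = f2 ∘ pr1 -> f1 = f2.
Proof.
move=> cW H; apply: cW.
have E (f : A ~> B) : del W ⊠ f = ⟨del _, f ∘ pr1⟩ ∘ swap W A.
  rewrite -[swap W A]comp_idr -pair_pr swap_pair pair_deterministic.
    exact: deterministic_pair (pr2_deterministic _ _) (pr1_deterministic _ _).
  by rewrite -compA pr1_pair del_nat tensmE del_nat.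
by rewrite !E H.
Qed.

(** A disintegration retains only [w], but [x] is a copy of the input and can be adjoined
    afterwards. This turns equal composites into almost sure equality with respect to [graph fs]. *)
Lemma disintegration_keep_input X W' Y W (fs : X ~> W) (fp fp' : (X ⊗ W) ⊗ W' ~> Y) :
  ⟨fp, pr2 ∘ pr1⟩ ∘ (graph fs ⊠ idm W')
    = ⟨fp', pr2 ∘ pr1⟩ ∘ (graph fs ⊠ idm W') ->
  ⟨fp, pr1⟩ ∘ (graph fs ⊠ idm W') = ⟨fp', pr1⟩ ∘ (graph fs ⊠ idm W').
Proof.
have E (k : (X ⊗ W) ⊗ W' ~> Y) : ⟨k, pr1⟩ ∘ (graph fs ⊠ idm W')
    = (idm _ ⊠ swap W X) ∘ assoc _ _ _
      ∘ ⟨⟨k, pr2 ∘ pr1⟩ ∘ (graph fs ⊠ idm W'), pr1⟩.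
  have -> : ⟨⟨k, pr2 ∘ pr1⟩ ∘ (graph fs ⊠ idm W'), pr1⟩
      = ⟨⟨k, pr2 ∘ pr1⟩, pr1 ∘ pr1⟩ ∘ (graph fs ⊠ idm W').
    rewrite -[X in ⟨X, pr1 ∘ pr1⟩]comp_idr -[pr1 ∘ pr1 in RHS]comp_idl.
    rewrite -tensm_pair -[RHS]compA (pair_tensm_exch _ (graph_copy fs)).
    by rewrite tensm_pair !comp_idl.
  rewrite -[RHS]compA (compA (assoc _ _ _)) assoc_pair compA tensm_pair.
  rewrite swap_pair comp_idl pr_pair //; exact: pr1_deterministic.
by rewrite !E => ->.
Qed.

Lemma feedback_unique X Y W (fs : X ~> W) (fp fp' : (X ⊗ W) ⊗ W ~> Y) :
  atomic_mor (graph fs) ->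
  ⟨fp, pr1⟩ ∘ (graph fs ⊠ idm W) = ⟨fp', pr1⟩ ∘ (graph fs ⊠ idm W) ->
  fp ∘ disint_state fs = fp' ∘ disint_state fs.
Proof.
set q := graph fs => at_q H.
(* [r] sends [((x1, w1), (x2, w2))] to [((x1, w1), w2)]. The parameter object in [as_eq] is taken to
   be the unit, which [a] discards. *)
pose r : (X ⊗ W) ⊗ (X ⊗ W) ~> (X ⊗ W) ⊗ W := idm _ ⊠ pr2.
pose a (k : (X ⊗ W) ⊗ W ~> Y) : munit ⊗ ((X ⊗ W) ⊗ (X ⊗ W)) ~> Y :=
  k ∘ r ∘ pr2.
have aE A (p : A ~> (X ⊗ W) ⊗ (X ⊗ W)) k :
    (a k ⊠ idm _) ∘ assoc_inv _ _ _ ∘ (idm munit ⊠ (copy _ ∘ p))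
    = ⟨k ∘ r, idm _⟩ ∘ p ∘ pr2.
  rewrite -tensm_compr compA -(compA (a k ⊠ _)) assoc_inv_copy tensm_pair.
  rewrite comp_idl comp_idr -[⟨_, idm _⟩ ∘ p ∘ _]compA -(pr2_tensm (idm munit)).
  rewrite compA (pair_deterministic (k ∘ r)); first exact: pr2_deterministic.
  by rewrite comp_idl.
(* Under [q ⊠ q] the input [w2] is independent of the first sample, so [k] enters only through
   [⟨k, pr1⟩ ∘ (q ⊠ idm _)], on which [fp] and [fp'] agree. *)
have rE (k : (X ⊗ W) ⊗ W ~> Y) : ⟨k ∘ r, idm _⟩ ∘ (q ⊠ q)
    = assoc _ _ _ ∘ ((⟨k, pr1⟩ ∘ (q ⊠ idm _)) ⊠ idm _)
      ∘ assoc_inv _ _ _ ∘ (idm _ ⊠ ⟨pr2, idm _⟩) ∘ (idm _ ⊠ q).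
  have r_det : deterministic r.
    rewrite /r tensmE; apply: deterministic_pair; apply: deterministic_comp;
      try exact: deterministic_id; try exact: pr2_deterministic.
    exact: pr1_deterministic.
  have S : ⟨k ∘ r, idm _⟩ = assoc _ _ _ ∘ (⟨k, pr1⟩ ⊠ idm _)
      ∘ assoc_inv _ _ _ ∘ (idm (X ⊗ W) ⊠ ⟨pr2, idm (X ⊗ W)⟩).
    rewrite (tensmE _ ⟨pr2, _⟩) (pair_deterministic pr2) //.
      exact: pr2_deterministic.
    rewrite !comp_idl -2!compA assoc_inv_pair tensm_pair comp_idl.
    have -> : ⟨pr1, pr2 ∘ pr2⟩ = r by rewrite /r tensmE comp_idl.
    by rewrite pair_deterministic // pr1_tensm comp_idl assoc_pair pair_pr.
  rewrite S (tensm_split q) -tensm_compl -!compA; do 2 congr (_ ∘ _).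
  rewrite -tensm_id (compA _ (assoc_inv _ _ _)) -assoc_inv_nat -compA.
  congr (_ ∘ _).
  by rewrite !tensm_id (compA _ (q ⊠ _)) (tensm_exch q) -[LHS]compA.
have : as_eq (q ⊠ q) (a fp) (a fp').
  by rewrite /as_eq !aE !rE H.
move/at_q; rewrite /as_eq !aE.
(* The unit input is filled in, and then the retained arguments are projected away. *)
move=> /(f_equal (fun z => z ∘ ⟨del _, idm _⟩)) /=.
rewrite -!(compA _ pr2) !pr2_pair !comp_idr => /(f_equal (comp pr1)).
rewrite (compA pr1) pr1_pair (compA pr1) pr1_pair -!(compA _ r) disint_stateE.
(* On the diagonal [w2] is [w1], which is exactly the feedback. *)
suff -> : r ∘ (copy _ ∘ q) = ⟨idm _, pr2⟩ ∘ q by [].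
by rewrite compA.
Qed.

Lemma causal_trace_unique X Y W (f : X ⊗ W ~> Y ⊗ W) (t t' : X ~> Y) :
  atomic C -> cancellative C ->
  is_causal_trace f t -> is_causal_trace f t' -> t = t'.
Proof.
move=> at_C can_C [fs [fp [d ->]]] [fs' [fp' [d' ->]]].
have E : fs = fs'.
  apply: (cancel_pr1 (can_C W)).
  by rewrite -(disintegration_state d) (disintegration_state d').
subst fs'; apply: feedback_unique; first exact: at_C.
apply: disintegration_keep_input.
by move/disintegrationE: d => <-; move/disintegrationE: d'.
Qed.

(** * Tightening *)

(** The conditional [l] samples [x] from [x'] and [w], and [⟨l, pr2⟩] is the [κ] of the overview. *)
Lemma graph_comp X X' W (hC : has_conditionals C) (fs : X ~> W) (g : X' ~> X) :
  exists l : X' ⊗ W ~> X, graph fs ∘ g = ⟨l, pr2⟩ ∘ graph (fs ∘ g).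
Proof.
have [k] := hC _ _ _ (⟨fs, idm X⟩ ∘ g).
rewrite /is_conditional -/pr1 (compA pr1) pr1_pair => H.
(* The conditional expects [W] first, whereas a graph lists it second. *)
exists (k ∘ swap X' W).
rewrite -[graph fs](@swap_pair _ _ _ fs) -compA H -[in LHS]compA -/(pair _ _).
rewrite -(compA _ (assoc _ _ _)) assoc_copy tensm_pair comp_idl comp_idr.
rewrite compA swap_pair.
have swapE : swap X' W = ⟨pr2, pr1⟩.
  by rewrite -[swap _ _]comp_idr -pair_pr swap_pair.
have swap_det : deterministic (swap X' W).
  rewrite swapE.
  exact: deterministic_pair (pr2_deterministic _ _) (pr1_deterministic _ _).
have -> : ⟨k ∘ swap X' W, pr2⟩ = ⟨k, pr1⟩ ∘ swap X' W.
  by rewrite pair_deterministic // swapE pr1_pair.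
by rewrite -compA swap_pair.
Qed.

Lemma is_causal_trace_tighten (hC : has_conditionals C) X X' Y Y' W
    (f : X ⊗ W ~> Y ⊗ W) (t : X ~> Y) (g : X' ~> X) (h : Y ~> Y') :
  is_causal_trace f t ->
  is_causal_trace ((h ⊠ idm W) ∘ f ∘ (g ⊠ idm W)) (h ∘ t ∘ g).
Proof.
case=> fs [fp [/disintegrationE d ->]].
have [l E] := graph_comp hC fs g; set κ := ⟨l, pr2⟩ in E.
(* [κ] passes [w] through unchanged, so [w] may be copied before or after [κ]; both the
   disintegration and the trace formula rest on this. *)
have K : ⟨idm _, pr2⟩ ∘ κ = ⟨κ, pr2⟩.
  by apply: pair_pr2_copy; exact: pr2_deterministic.
exists (fs ∘ g), (h ∘ fp ∘ (κ ⊠ idm W)); split.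
  apply/disintegrationE.
  rewrite d compA tensm_pair comp_idl -[LHS]compA tensm_compl E -tensm_compl.
  rewrite compA; congr (_ ∘ _).
  rewrite -[pr2 ∘ pr1 in LHS]comp_idl -(comp_idr (h ∘ fp)) -tensm_pair.
  rewrite -compA (pair_tensm_exch _ K) tensm_pair comp_idl.
  by rewrite !compA !comp_idr.
have S : disint_state fs ∘ g = (κ ⊠ idm W) ∘ disint_state (fs ∘ g).
  rewrite !disint_stateE -[LHS]compA E compA K.
  by rewrite [RHS]compA tensm_pair comp_idr comp_idl.
by rewrite -[LHS]compA -(compA fp) S 2![LHS]compA.
Qed.
End Calculus.

Theorem proposition18 (C : markov_cat) (hcond : has_conditionals C)
  (hatom : atomic C) (hcanc : cancellative C) (X X' Y Y' W : C)
  (f : X ⊗ W ~> Y ⊗ W) (g : X' ~> X) (h : Y ~> Y') (hf : traceable f) :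
  exists hf' : traceable ((h ⊠ idm W) ∘ f ∘ (g ⊠ idm W)),
    causal_trace hcond hf' = h ∘ causal_trace hcond hf ∘ g.
Proof.
have ctP X1 Y1 (f1 : X1 ⊗ W ~> Y1 ⊗ W) (hf1 : traceable f1) :
    is_causal_trace f1 (causal_trace hcond hf1).
  by rewrite /causal_trace; case: constructive_indefinite_description.
have T := is_causal_trace_tighten hcond g h (ctP _ _ _ hf).
(* Traceability is read off the disintegration that [T] provides. *)
have hf' : traceable ((h ⊠ idm W) ∘ f ∘ (g ⊠ idm W)).
  by case: (T) => fs [fp [d _]]; apply: disintegration_nonsignalling d.
exists hf'; exact: causal_trace_unique hatom hcanc (ctP _ _ _ hf') T.
Qed.
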